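(* Consider the $K$-medoids problem on samples $x(1),\ldots,x(N)$ (with $1\le K<N$) lying in a metric space with metric $\mathrm{dist}$, with dissimilarity $f(x(i),x(j))=e(\mathrm{dist}(x(i),x(j)))$, where $e:\mathbb{R}_{\ge 0}\to\mathbb{R}_{\ge 0}$ satisfies $e(0)=0$ and $v_1\le v_2 \iff e(v_1)\le e(v_2)$. For a set $\mathcal{C}\subset\{1,\ldots,N\}$ of $K$ center indices, define the energy $E(\mathcal{C})=\frac1N\sum_{i=1}^N\min_{i'\in\mathcal{C}} f(x(i),x(i'))$. (1) If $\mathcal{C}$ is a local minimum of \texttt{clarans} (that is, for every $i_-\in\mathcal{C}$ and every $i_+\in\{1,\ldots,N\}\setminus\mathcal{C}$ one has $E(\mathcal{C}\setminus\{i_-\}\cup\{i_+\})\ge E(\mathcal{C})$), then $\mathcal{C}$ is a local minimum of \texttt{medlloyd} (that is, for each center $c\in\mathcal{C}$, $c$ is a medoid of its cluster: $\sum_{i\in S_c} f(x(i),x(c))\le \sum_{i\in S_c} f(x(i),x(m))$ for every $m\in S_c$, where the clusters $S_c$, $c\in\mathcal{C}$, partition $\{1,\ldots,N\}$ by assigning each index to a center in $\mathcal{C}$ at minimal dissimilarity, ties broken arbitrarily except that each center index $c$ is assigned to its own cluster $S_c$). (2) There exist instances (e.g. with points in Euclidean space and $f$ the squared Euclidean distance) and center sets $\mathcal{C}$ that are local minima of \texttt{medlloyd} but not local minima of \texttt{clarans}.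
   Context: \texttt{medlloyd} (also called \texttt{vik}, the Voronoi iteration algorithm) is the $K$-medoids analogue of Lloyd's algorithm: it alternates between assigning each sample to its nearest current center and replacing each center by the medoid of its cluster, i.e. the cluster member minimizing the sum of dissimilarities to the other members of the cluster; its local minima (fixed points) are configurations in which every center is already a medoid of its cluster. \texttt{clarans} is the swap-based $K$-medoids algorithm that repeatedly proposes replacing a center index $i_-\in\mathcal{C}$ by a non-center index $i_+\notin\mathcal{C}$ and accepts the swap only if the energy $E$ strictly decreases; its local minima are configurations from which no such swap decreases $E$. *)

(* Defs.v *)
From HB Require Import structures.
From mathcomp Require Import all_boot all_order all_algebra.
From mathcomp Require Import boolp classical_sets reals topology.
From mathcomp Require Import lra ring.

Set Implicit Arguments.
Unset Strict Implicit.
Unset Printing Implicit Defensive.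

Import Order.TTheory GRing.Theory Num.Theory.
Local Open Scope ring_scope.

Section MinSeq.
Context {R : realType}.
Implicit Types (s : seq R) (v : R).

(* The unit of the iterated minimum is itself an element of s whenever s is
   nonempty, so that min_seq s is the minimum of s (min_seq [::] = 0 is junk). *)
Definition min_seq s : R := \big[Num.min/head 0 s]_(v <- s) v.

Lemma min_seq_le s v : v \in s -> min_seq s <= v.
Proof.
rewrite /min_seq; move: (head 0 s) => v0; elim: s => [//|w s IHs].
rewrite inE big_cons ge_min => /predU1P[->|/IHs ->]; first by rewrite lexx.
by rewrite orbT.
Qed.

Lemma min_seq_mem s : s != [::] -> min_seq s \in s.
Proof.
rewrite /min_seq big_seq.
case: s => [//|v s] _; elim/big_ind : _ => [|a b As Bs|//].
- exact: mem_head.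
- by rewrite /Num.min; case: ifP.
Qed.

End MinSeq.

Section KMedoids.
Context {R : realType} {N : nat}.

Definition dissimilarity {T : metricType R} (e : R -> R) (x : 'I_N -> T)
  (i j : 'I_N) : R := e (mdist (x i) (x j)).

Implicit Types (f : 'I_N -> 'I_N -> R) (C : {set 'I_N}) (a : 'I_N -> 'I_N).

Definition energy f C : R :=
  N%:R^-1 * \sum_(i < N) min_seq [seq f i c | c in C].

Definition clarans_local_min f C : Prop :=
  forall i_minus i_plus, i_minus \in C -> i_plus \notin C ->
    energy f C <= energy f (i_plus |: (C :\ i_minus)).

(* a i is the center to which the index i is assigned *)
Definition is_assignment f C a : Prop :=
  [/\ forall i, a i \in C,
      forall i c, c \in C -> f i (a i) <= f i c &
      forall c, c \in C -> a c = c].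

Definition cluster a (c : 'I_N) : {set 'I_N} := [set i | a i == c].

Definition is_medoid f (S : {set 'I_N}) (c : 'I_N) : Prop :=
  forall m, m \in S -> \sum_(i in S) f i c <= \sum_(i in S) f i m.

(* Ties are broken arbitrarily: the condition is imposed for every admissible
   assignment. One always exists, see is_assignment_exists. *)
Definition medlloyd_local_min f C : Prop :=
  forall a, is_assignment f C a ->
    forall c, c \in C -> is_medoid f (cluster a c) c.

Lemma is_assignment_exists f C :
  (forall i j, 0 <= f i j) -> (forall i, f i i = 0) -> (0 < #|C|)%N ->
  exists a, is_assignment f C a.
Proof.
move=> f0 fii /card_gt0P[c0 c0C].
exists (fun i => if i \in C then i else [arg min_(c < c0 in C) f i c]%O).
split=> [i|i c cC|c ->//].
- by case: ifPn => // _; case: arg_minP.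
- by case: ifPn => [_|_]; [rewrite fii | case: arg_minP => // j _; apply].
Qed.

End KMedoids.

(* The d-dimensional Euclidean space: an alias of 'rV[R]_d, whose own metric in
   the library is the one of the sup norm. *)
Definition euclidean (R : realType) (d : nat) : Type := 'rV[R]_d.

HB.instance Definition _ (R : realType) (d : nat) :=
  Choice.copy (euclidean R d) 'rV[R]_d.

Section Euclidean.
Context {R : realType} {d : nat}.
Implicit Types (u v : 'rV[R]_d).

Definition euclidean_dist u v : R :=
  Num.sqrt (\sum_(k < d) (u ord0 k - v ord0 k) ^+ 2).

Let sumsq_ge0 (u : 'I_d -> R) : 0 <= \sum_k u k ^+ 2.
Proof. by apply: sumr_ge0 => k _; exact: sqr_ge0. Qed.

Lemma euclidean_distxx u : euclidean_dist u u = 0.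
Proof.
rewrite /euclidean_dist big1 ?sqrtr0// => k _.
by rewrite subrr expr0n.
Qed.

Lemma euclidean_dist_eq0 u v : euclidean_dist u v = 0 -> u = v.
Proof.
move=> /eqP; rewrite sqrtr_eq0 => le0; apply/rowP => k; apply/eqP.
have /eqP : \sum_(k < d) (u ord0 k - v ord0 k) ^+ 2 = 0.
  by apply/eqP; rewrite eq_le le0 sumsq_ge0.
rewrite psumr_eq0 => [/allP/(_ k (mem_index_enum k))|i _]; last exact: sqr_ge0.
by rewrite /= sqrf_eq0 subr_eq0.
Qed.

Lemma euclidean_dist_sym u v : euclidean_dist u v = euclidean_dist v u.
Proof.
by congr Num.sqrt; apply: eq_bigr => k _; rewrite -sqrrN opprB.
Qed.

Let cauchy_schwarz (a b : 'I_d -> R) :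
  \sum_k a k * b k <=
  Num.sqrt (\sum_k a k ^+ 2) * Num.sqrt (\sum_k b k ^+ 2).
Proof.
have null (p q : 'I_d -> R) :
    Num.sqrt (\sum_k p k ^+ 2) = 0 -> \sum_k p k * q k = 0.
  move=> /eqP; rewrite sqrtr_eq0 => le0; apply: big1 => k _.
  have /eqP : \sum_k p k ^+ 2 = 0 by apply/eqP; rewrite eq_le le0 sumsq_ge0.
  rewrite psumr_eq0 => [|i _]; last exact: sqr_ge0.
  move=> /allP/(_ k (mem_index_enum k)); rewrite /= sqrf_eq0 => /eqP ->.
  by rewrite mul0r.
set s := Num.sqrt (\sum_k a k ^+ 2); set t := Num.sqrt (\sum_k b k ^+ 2).
have [s0|s_neq0] := eqVneq s 0; first by rewrite s0 mul0r null.
have [t0|t_neq0] := eqVneq t 0.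
  by under eq_bigr do rewrite mulrC; rewrite t0 mulr0 null.
have s_gt0 : 0 < s by rewrite lt_neqAle eq_sym s_neq0 sqrtr_ge0.
have t_gt0 : 0 < t by rewrite lt_neqAle eq_sym t_neq0 sqrtr_ge0.
have := sumsq_ge0 (fun k => t * a k - s * b k).
have -> : \sum_k (t * a k - s * b k) ^+ 2 =
    t ^+ 2 * \sum_k a k ^+ 2 - (2 * s * t) * \sum_k a k * b k
    + s ^+ 2 * \sum_k b k ^+ 2.
  rewrite !mulr_sumr -sumrB -big_split/=; apply: eq_bigr => k _; ring.
rewrite -[X in t ^+ 2 * X]sqr_sqrtr// -[X in s ^+ 2 * X]sqr_sqrtr// -/s -/t.
set P := \sum_k _.
have -> : t ^+ 2 * s ^+ 2 - 2 * s * t * P + s ^+ 2 * t ^+ 2 =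
  (2 * (s * t)) * (s * t - P) by ring.
by rewrite pmulr_rge0 ?subr_ge0// !mulr_gt0.
Qed.

Lemma euclidean_dist_triangle v u w :
  euclidean_dist u w <= euclidean_dist u v + euclidean_dist v w.
Proof.
pose a k := u ord0 k - v ord0 k; pose b k := v ord0 k - w ord0 k.
rewrite -(@ler_pXn2r _ 2)// ?nnegrE ?addr_ge0 ?sqrtr_ge0//.
rewrite sqrrD !sqr_sqrtr ?sumsq_ge0//.
have -> : \sum_k (u ord0 k - w ord0 k) ^+ 2 =
    \sum_k a k ^+ 2 + (\sum_k a k * b k) *+ 2 + \sum_k b k ^+ 2.
  rewrite -sumrMnl -!big_split/=; apply: eq_bigr => k _.
  by rewrite /a /b; ring.
by rewrite lerD2r lerD2l lerMn2r/=; exact: cauchy_schwarz.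
Qed.

End Euclidean.

HB.instance Definition _ (R : realType) (d : nat) :=
  @isMetric.Build R (euclidean R d) (@euclidean_dist R d) euclidean_distxx
    euclidean_dist_eq0 euclidean_dist_sym euclidean_dist_triangle.

(* On Euclidean spaces mdist is the Euclidean distance. *)
Lemma mdist_euclideanE (R : realType) (d : nat) (u v : euclidean R d) :
  mdist u v = euclidean_dist u v.
Proof. by []. Qed.

(* Main.v *)
Require Import Defs.
From HB Require Import structures.
From mathcomp Require Import all_boot all_order all_algebra.
From mathcomp Require Import reals topology.
From mathcomp Require Import lra.

Set Implicit Arguments.
Unset Strict Implicit.
Unset Printing Implicit Defensive.

Import Order.TTheory GRing.Theory Num.Theory.
Local Open Scope ring_scope.

(* Let m lie in the cluster of the center c, m <> c. Keeping the assignment of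
   all other samples and sending the whole cluster of c to m gives an upper bound
   on the energy after the swap of c for m; the two energies differ at most by
   the difference of the two within-cluster sums, so a configuration without
   improving swaps has medoids as centers. For the converse, take the points
   0, 1, 3 on the line with the first two as centers: the clusters {0} and {1, 3}
   have at most two elements, hence every member is a medoid, but
   replacing the center 0 by 3 lowers the total from 4 to 1. *)

Section Energy.
Context {R : realType} {N : nat}.
Implicit Types (f : 'I_N -> 'I_N -> R) (C : {set 'I_N}) (a b : 'I_N -> 'I_N).

(** Each minimum over [C] is at most the value at any chosen center. Since [b] need not be optimal
    or fix the centers, this applies to ad hoc reassignments after a swap. *)
Lemma energy_le f C b : (forall i, b i \in C) ->
  energy f C <= N%:R^-1 * \sum_(i < N) f i (b i).
Proof.
move=> bC; rewrite /energy ler_wpM2l ?invr_ge0 ?ler0n//.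
by apply: ler_sum => i _; apply: min_seq_le; apply: image_f.
Qed.

Lemma energy_assignment f C a : is_assignment f C a ->
  energy f C = N%:R^-1 * \sum_(i < N) f i (a i).
Proof.
move=> [aC amin _]; apply/eqP; rewrite eq_le energy_le//=.
rewrite /energy ler_wpM2l ?invr_ge0 ?ler0n//; apply: ler_sum => i _.
(* The value at [a i] makes the list nonempty, so its minimum is attained at a center and is not the
   default 0. *)
have /min_seq_mem/imageP[c cC ->] : [seq f i c | c in C] != [::].
  by apply/eqP => E; have := image_f (f i) (aC i); rewrite E.
exact: amin.
Qed.

Lemma clarans_medlloyd_local_min f C :
  clarans_local_min f C -> medlloyd_local_min f C.
Proof.
move=> fC a aP c cC m mS; have [aC _ aid] := aP.
have [->//|m_neq_c] := eqVneq m c.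
(* A center is assigned to itself, so the only center in the cluster of [c] is [c]; hence swapping
   [c] for [m] is a legal move. *)
have mNC : m \notin C.
  apply: contraNN m_neq_c => /aid am.
  by move: mS; rewrite inE am.
have N_gt0 : (0 < N)%N by exact: leq_ltn_trans (leq0n m) (ltn_ord m).
pose b i := if a i == c then m else a i.
have bC i : b i \in m |: (C :\ c).
  by rewrite /b; case: ifPn => aic; rewrite !inE ?eqxx// aic aC orbT.
have := le_trans (fC _ _ cC mNC) (energy_le f bC).
rewrite (energy_assignment aP) ler_pM2l ?invr_gt0 ?ltr0n//.
(* Outside [S] the maps [a] and [b] agree, so those terms cancel. *)
pose S := Defs.cluster a c; rewrite (bigID (mem S)) /= [leRHS](bigID (mem S)) /=.
have -> : \sum_(i in S) f i (a i) = \sum_(i in S) f i c.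
  by apply: eq_bigr => i; rewrite inE => /eqP ->.
have -> : \sum_(i in S) f i (b i) = \sum_(i in S) f i m.
  by apply: eq_bigr => i; rewrite inE /b => ->.
have -> : \sum_(i | i \notin S) f i (b i) =
          \sum_(i | i \notin S) f i (a i).
  by apply: eq_bigr => i; rewrite inE /b => /negPf ->.
by rewrite lerD2r.
Qed.

(** For a pair, the zero diagonal and symmetry make both within-cluster sums equal to [f c m]. *)
Lemma is_medoid_card_le2 f (S : {set 'I_N}) (c : 'I_N) :
  (forall i, f i i = 0) -> (forall i j, f i j = f j i) ->
  c \in S -> (#|S| <= 2)%N -> is_medoid f S c.
Proof.
move=> f0 fC cS S2 m mS; have [->//|m_neq_c] := eqVneq m c.
have -> : S = [set c; m].
  apply/esym/eqP; rewrite eqEcard cards2 eq_sym m_neq_c S2 andbT.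
  by apply/subsetP => i; rewrite !inE => /orP[]/eqP ->.
by rewrite !big_setU1 ?inE 1?eq_sym//= !big_set1 !f0 addr0 add0r fC.
Qed.

End Energy.

Section ThreePoints.
Context {R : realType}.

Definition three_points (i : 'I_3) : euclidean R 1 :=
  const_mx (nth 0 [:: 0; 1; 3] i).

Definition three_points_centers : {set 'I_3} := [set~ ord_max].

Local Notation f := (dissimilarity (fun v : R => v ^+ 2) three_points).

Lemma three_points_dissimilarity i j :
  f i j = (nth 0 [:: 0; 1; 3] i - nth 0 [:: 0; 1; 3] j) ^+ 2.
Proof.
rewrite /dissimilarity mdist_euclideanE /euclidean_dist big_ord1 !mxE.
by rewrite sqr_sqrtr// sqr_ge0.
Qed.

Lemma three_points_medlloyd_local_min :
  medlloyd_local_min f three_points_centers.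
Proof.
move=> a [_ _ aid] c cC; apply: is_medoid_card_le2.
- by move=> i; rewrite three_points_dissimilarity subrr expr0n.
- by move=> i j; rewrite !three_points_dissimilarity -sqrrN opprB.
- by rewrite inE aid.
(* The other center lies outside the cluster of [c], which thus misses one of the three indices,
   whatever the assignment. *)
have [c' c'C c'_neq_c] : exists2 c', c' \in three_points_centers & c' != c.
  exists (if c == ord0 then inord 1 else ord0).
    by case: ifP => _; rewrite !inE -val_eqE /= ?inordK.
  by have [->|] := eqVneq c ord0; rewrite -?val_eqE /= ?inordK// eq_sym.
rewrite -ltnS -[X in (_ < X)%N](card_ord 3) -cardsT; apply: proper_card.
by rewrite properT; apply/eqP => /setP/(_ c'); rewrite !inE aid// (negPf c'_neq_c).
Qed.

Lemma three_points_not_clarans_local_min :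
  ~ clarans_local_min f three_points_centers.
Proof.
pose i1 : 'I_3 := inord 1.
have i1E : i1 = 1%N :> nat by rewrite inordK.
(* The point 3 is nearer to 1 (cost 4) than to 0 (cost 9). *)
pose a i := if i == ord_max then i1 else i.
have aP : is_assignment f three_points_centers a.
  split=> [i|i c|c]; rewrite /a ?inE.
  - by case: ifPn => // _; rewrite -val_eqE /= i1E.
  - have [->|_ _] := eqVneq i ord_max; last first.
      by rewrite !three_points_dissimilarity subrr expr0n sqr_ge0.
    rewrite !three_points_dissimilarity i1E -val_eqE /=.
    by case: c => -[|[|[|//]]] //= _ _; lra.
  - by move/negPf ->.
(* After the swap, sending the point 0 to 1 costs 1 and the other points are centers; local
   minimality would give 4 <= 1. *)
pose b i := if i == ord0 then i1 else i.
have bC i : b i \in ord_max |: (three_points_centers :\ ord0).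
  rewrite /b; case: eqVneq => [_|i_neq0]; rewrite !inE -!val_eqE /= ?i1E//.
  by move: i_neq0; rewrite -val_eqE /= => ->; case: (_ == _).
move=> /(_ ord0 ord_max); rewrite !inE eqxx => /(_ isT isT).
move=> /le_trans/(_ (energy_le f bC)).
rewrite (energy_assignment aP) ler_pM2l ?invr_gt0 ?ltr0n//.
rewrite !big_ord_recr !big_ord0 /= !three_points_dissimilarity /a /b -!val_eqE /=.
rewrite ?i1E /=; lra.
Qed.

End ThreePoints.

Theorem theorem1 (R : realType) :
  (forall (T : metricType R) (e : R -> R) (N K : nat) (x : 'I_N -> T)
          (C : {set 'I_N}),
      (1 <= K < N)%N ->
      (forall v : R, 0 <= v -> 0 <= e v) ->
      e 0 = 0 ->
      (forall v1 v2 : R, 0 <= v1 -> 0 <= v2 -> (v1 <= v2 <-> e v1 <= e v2)) ->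
      #|C| = K ->
      clarans_local_min (dissimilarity e x) C ->
      medlloyd_local_min (dissimilarity e x) C)
  /\
  (exists (d N K : nat) (x : 'I_N -> euclidean R d) (C : {set 'I_N}),
      [/\ (1 <= K < N)%N,
          #|C| = K,
          medlloyd_local_min (dissimilarity (fun v : R => v ^+ 2) x) C &
          ~ clarans_local_min (dissimilarity (fun v : R => v ^+ 2) x) C]).
Proof.
split=> [T e N K x C _ _ _ _ _|]; first exact: clarans_medlloyd_local_min.
exists 1%N, 3%N, 2%N, three_points, three_points_centers; split=> //.
- by rewrite cardsC1 card_ord.
- exact: three_points_medlloyd_local_min.
- exact: three_points_not_clarans_local_min.
Qed.
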